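(* Let $f_1,\dots,f_N:\mathcal{X}\to\mathbb{R}$ be such that each $f_i$ is strictly convex, continuously differentiable, and has a minimizer $x_i^*\in\mathcal{X}$. Let $(u(k))_{k=1}^\infty$ be a sequence of gossiping pairs such that the graph $(\mathcal{V},\mathcal{E}_\infty)$ is connected, and let $\mathbf{x}(k)=(\hat{x}_1(k),\dots,\hat{x}_N(k))$, $k\in\mathbb{N}$, be a sequence of estimates generated by Pairwise Bisectioning (PB) along $(u(k))_{k=1}^\infty$. Then $$\lim_{k\to\infty}V(\mathbf{x}(k))=0\qquad\text{and}\qquad \lim_{k\to\infty}\hat{x}_i(k)=x^*\quad\forall i\in\mathcal{V}.$$
   Context: Let $N\ge 2$, $\mathcal{V}=\{1,2,\dots,N\}$, $\mathbb{N}=\{0,1,2,\dots\}$, $\mathbb{P}=\{1,2,\dots\}$, and let $\mathcal{X}\subset\mathbb{R}$ be a nonempty open interval. For each time $k$ the network is an undirected graph $(\mathcal{V},\mathcal{E}(k))$, where $\mathcal{E}(k)\subset\{\{i,j\}:i,j\in\mathcal{V},i\ne j\}$ is nonempty. A sequence of gossiping pairs is a sequence $(u(k))_{k=1}^\infty$ with $u(k)=\{u_1(k),u_2(k)\}\in\mathcal{E}(k)$ a pair of distinct nodes for every $k\in\mathbb{P}$ (the topology is arbitrary and time-varying, so $u(k)$ may be any pair of distinct nodes). Define $\mathcal{E}_\infty=\{\{i,j\}: u(k)=\{i,j\}\text{ for infinitely many }k\in\mathbb{P}\}$. Let $F(x)=\sum_{i\in\mathcal{V}}f_i(x)$ for $x\in\mathcal{X}$,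 and let $x^*$ denote the unique minimizer of $F$ over $\mathcal{X}$ (it exists under the stated assumptions on the $f_i$). Derivatives are denoted $f_i'$. Pairwise Bisectioning (PB): initialize $\hat{x}_i(0)=x_i^*$ for all $i\in\mathcal{V}$. At each iteration $k\in\mathbb{P}$, nodes not in $u(k)$ keep their estimates: $\hat{x}_l(k)=\hat{x}_l(k-1)$ for $l\notin u(k)$. The two nodes of $u(k)$ are given roles $i$ (initiator) and $j$ in an arbitrary way, so $u(k)=\{i,j\}$, and an arbitrary number of bisection rounds $R\in\mathbb{P}$ (which may depend on $k$) is selected. Write $\hat{x}_i,\hat{x}_j$ for the current values $\hat{x}_i(k-1),\hat{x}_j(k-1)$. (1) Set $a=\min\{\hat{x}_i,\hat{x}_j\}$ and $b=\max\{\hat{x}_i,\hat{x}_j\}$ (both nodes keep identical copies $a_i=a_j=a$, $b_i=b_j=b$). (2) Repeat $R$ times: if $f_j'(\frac{a+b}{2})-f_j'(\hat{x}_j)+f_i'(\frac{a+b}{2})-f_i'(\hat{x}_i)\ge 0$, replace $b$ by $\frac{a+b}{2}$; otherwise replace $a$ by $\frac{a+b}{2}$. (3) For $l\in\{i,j\}$ let $c_l=a$ if $\hat{x}_l\le a$ and $c_l=b$ if $\hat{x}_l\ge b$. If $$\bigl(f_j'(c_j)-f_j'(\hat{x}_j)+f_i'(c_i)-f_i'(\hat{x}_i)\bigr)\bigl(\hat{x}_i-\tfrac{a+b}{2}\bigr)\ge 0,$$ then set $\hat{x}_i(k)=(f_i')^{-1}\bigl(f_i'(\hat{x}_i)-f_j'(c_j)+f_j'(\hat{x}_j)\bigr)$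 and $\hat{x}_j(k)=c_j$. Otherwise set $\hat{x}_i(k)=c_i$ and $\hat{x}_j(k)=(f_j')^{-1}\bigl(f_j'(\hat{x}_j)-f_i'(c_i)+f_i'(\hat{x}_i)\bigr)$. All right-hand sides use the old values $\hat{x}_i=\hat{x}_i(k-1)$, $\hat{x}_j=\hat{x}_j(k-1)$; $(f_l')^{-1}$ is the inverse of the injective function $f_l'$ on its range. The function $V:\mathcal{X}^N\to\mathbb{R}$ is $$V(x_1,\dots,x_N)=\sum_{i\in\mathcal{V}}\Bigl(f_i(x^* )-f_i(x_i)-f_i'(x_i)(x^*-x_i)\Bigr).$$ *)

(* Defs.v *)
From HB Require Import structures.
From mathcomp Require Import all_boot all_order all_algebra.
From mathcomp Require Import all_classical all_reals all_analysis.

Set Implicit Arguments.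
Unset Strict Implicit.
Unset Printing Implicit Defensive.

Import Order.TTheory GRing.Theory Num.Theory.
Import numFieldNormedType.Exports.

Local Open Scope classical_set_scope.
Local Open Scope ring_scope.

(* A function X -> R with X a subset of R is represented by a total function
   R -> R; all notions below depend only on its values on the open set X. *)

Definition strictly_convex_on (R : realType) (X : set R) (g : R -> R) : Prop :=
  forall x y t : R, X x -> X y -> x != y -> 0 < t -> t < 1 ->
    g (t * x + (1 - t) * y) < t * g x + (1 - t) * g y.

Definition continuously_differentiable_on (R : realType) (X : set R)
    (g : R -> R) : Prop :=
  (forall x : R, X x -> derivable g x 1) /\ {within X, continuous (derive1 g)}.

Definition minimizer_on (R : realType) (X : set R) (g : R -> R) (x : R) : Prop :=
  X x /\ forall y : R, X y -> g x <= g y.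

Section Network.
Variable N : nat.

(* Nodes are numbered from 0; only the values u k with 0 < k are used. *)
Definition gossiping_pairs (u : nat -> {set 'I_N}) : Prop :=
  forall k : nat, (0 < k)%N -> #|u k| = 2%N.

Definition E_infty (u : nat -> {set 'I_N}) : rel 'I_N :=
  fun i j => (i != j) &&
    `[< infinite_set [set k : nat | (0 < k)%N /\ u k = [set i; j]%SET] >].

Definition graph_connected (e : rel 'I_N) : Prop :=
  forall i j : 'I_N, connect e i j.

End Network.

Section PairwiseBisectioning.
Variables (R : realType) (N : nat) (X : set R) (f : 'I_N -> R -> R).

Definition total_objective (x : R) : R := \sum_(i < N) f i x.

Definition bisect (g : R -> R) (ab : R * R) : R * R :=
  let m := (ab.1 + ab.2) / 2 in
  if 0 <= g m then (ab.1, m) else (m, ab.2).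

(* During the bisection every estimate x of the pair satisfies x <= a or
   b <= x, so that the last branch means b <= x. *)
Definition nearest_endpoint (a b x : R) : R := if x <= a then a else b.

(* Inverse of f_l' restricted to X; its value outside f_l' @` X is a dummy. *)
Definition inv_deriv (l : 'I_N) : R -> R := 'pinv_(fun=> 0) X (derive1 (f l)).

(* One iteration with initiator i, partner j and r bisection rounds, from the
   current estimates x. *)
Definition PB_step (i j : 'I_N) (r : nat) (x : 'I_N -> R) : 'I_N -> R :=
  let df l := derive1 (f l) in
  let g z := df j z - df j (x j) + df i z - df i (x i) in
  let ab := iter r (bisect g) (Num.min (x i) (x j), Num.max (x i) (x j)) in
  let a := ab.1 in
  let b := ab.2 in
  let ci := nearest_endpoint a b (x i) in
  let cj := nearest_endpoint a b (x j) in
  let: (yi, yj) :=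
    if 0 <= (df j cj - df j (x j) + df i ci - df i (x i))
            * (x i - (a + b) / 2)
    then (inv_deriv i (df i (x i) - df j cj + df j (x j)), cj)
    else (ci, inv_deriv j (df j (x j) - df i ci + df i (x i))) in
  fun l => if l == i then yi else if l == j then yj else x l.

Definition PB_sequence (xmin : 'I_N -> R) (u : nat -> {set 'I_N})
    (xhat : nat -> 'I_N -> R) : Prop :=
  (forall i : 'I_N, xhat 0%N i = xmin i) /\
  forall k : nat, (0 < k)%N ->
    exists (i j : 'I_N) (r : nat),
      [/\ u k = [set i; j]%SET, (0 < r)%N &
          forall l : 'I_N, xhat k l = PB_step i j r (xhat k.-1) l].

Definition V (xstar : R) (x : 'I_N -> R) : R :=
  \sum_(i < N) (f i xstar - f i (x i) - derive1 (f i) (x i) * (xstar - x i)).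

End PairwiseBisectioning.

(* Main.v *)
Require Import Defs.
From HB Require Import structures.
From mathcomp Require Import all_boot all_order all_algebra.
From mathcomp Require Import all_classical all_reals all_analysis.
From mathcomp Require Import ring lra.

Set Implicit Arguments.
Unset Strict Implicit.

Import Order.TTheory GRing.Theory Num.Theory.
Import numFieldNormedType.Exports.

Local Open Scope classical_set_scope.
Local Open Scope ring_scope.

(** Write h_i for the derivative of f_i; it is continuous and strictly
    increasing on X.  Whatever the number of bisection rounds and whichever
    branch is taken, an iteration of the algorithm moves the two estimates of
    the gossiping pair towards each other without letting them cross, keeps the
    sum of the h_i at the estimates, and at least halves the gap of the pair
    (PB_step_inward, the predicate inward_move).

    Since h_i vanishes at the minimizer of f_i, the sum of h_i (x_i) over all
    nodes is 0 forever, whereas the minimizer of the total objective is the zero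
    c of the sum of the h_i.  Hence c always lies between the smallest and the
    largest estimate, and it suffices to show that the spread of the estimates
    tends to 0.

    The function V is a sum of Bregman divergences, and one inward move lowers
    it by at least the Bregman divergences travelled by the two nodes
    (V_inward_move).  All estimates stay in a compact interval of X, where a
    divergence between points at distance at least d is bounded below by some
    w > 0; as V is nonnegative and nonincreasing, the distances travelled tend
    to 0.  A pair halves its gap when it gossips, so the gaps of the gossiping
    pairs tend to 0 as well (gossiping_gap_cvg0).

    That already forces consensus (inward_gossip_consensus).  If the spread is
    at least N * d at a time after which only pairs with gap less than d gossip,
    then by the pigeonhole principle some interval of length d separates the
    estimates into two nonempty groups.  No later gossip can join the two
    groups, and moves inside a group leave the interval empty; so the groups
    never communicate again, contradicting the connectivity of the graph of the
    pairs that gossip infinitely often. *)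

(** * Strictly convex functions and Bregman divergences *)

Section StrictlyConvex.
Context {R : realType} {X : set R}.
Hypotheses (X_open : open X) (X_interval : is_interval X).

Definition bregman (g : R -> R) (z x : R) : R :=
  g z - g x - derive1 g x * (z - x).

Section OneFunction.
Context {g : R -> R}.
Hypotheses (g_convex : strictly_convex_on X g)
           (g_C1 : continuously_differentiable_on X g).

(** The convexity inequality bounds the difference quotient of g from x in the
    direction z - x by g z - g x; the derivative is its limit from the right. *)
Lemma bregman_ge0 (z x : R) : X z -> X x -> 0 <= bregman g z x.
Proof.
move=> Xz Xx; have [->|zx] := eqVneq z x.
  by rewrite /bregman !subrr mulr0 subrr.
have diffg : differentiable g x by apply/derivable1_diffP; exact: g_C1.1.
have Dg : 'D_(z - x) g x = derive1 g x * (z - x).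
  rewrite deriveE // derive1E' // -[X in 'd g x X](mulr1 (z - x)).
  by rewrite -[X in 'd g x X]/((z - x) *: 1) linearZ /= mulrC.
have /cvg_dnbhs_at_right cvgD := diff_derivable (v := z - x) diffg.
rewrite /bregman subr_ge0 -Dg.
apply: (cvgr_to_le cvgD); near=> t.
have t0 : 0 < t by near: t; exact: nbhs_right_gt.
have t1 : t < 1 by near: t; exact: nbhs_right_lt.
rewrite /= -[_ *: (_ - _)]/(_ * _) ler_pdivrMl // -[_ *: _]/(_ * _).
have := g_convex Xz Xx zx t0 t1.
have -> : t * z + (1 - t) * x = t * (z - x) + x by ring.
by move=> /ltW; nra.
Unshelve. all: by end_near.
Qed.

Lemma X_midpoint (z x : R) : X z -> X x -> X ((x + z) / 2).
Proof.
by move=> Xz Xx; have [zx|xz] := leP z x;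
  [apply: X_interval Xz Xx _ _|apply: X_interval Xx Xz _ _]; lra.
Qed.

(** At the midpoint, g is at least the tangent at x and strictly less than the
    average of g z and g x. *)
Lemma bregman_gt0 (z x : R) : X z -> X x -> z != x -> 0 < bregman g z x.
Proof.
move=> Xz Xx zx; have := bregman_ge0 (X_midpoint Xz Xx) Xx.
have h0 : 0 < 1 / 2 :> R by lra.
have h1 : 1 / 2 < 1 :> R by lra.
have := g_convex Xz Xx zx h0 h1; rewrite /bregman.
have -> : 1 / 2 * z + (1 - 1 / 2) * x = (x + z) / 2 by field.
have -> : (x + z) / 2 - x = (z - x) / 2 by field.
by lra.
Qed.

Lemma derive1_increasing (x y : R) : X x -> X y ->
  x < y -> derive1 g x < derive1 g y.
Proof.
move=> Xx Xy xy.
have := bregman_gt0 Xx Xy (negbT (lt_eqF xy)).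
have := bregman_gt0 Xy Xx (negbT (gt_eqF xy)).
by rewrite /bregman; nra.
Qed.

Lemma derive1_le (x y : R) : X x -> X y ->
  (derive1 g x <= derive1 g y) = (x <= y).
Proof.
move=> Xx Xy; have [xy|yx|->] := ltgtP x y; last by rewrite lexx.
  by rewrite ltW // derive1_increasing.
by rewrite leNgt derive1_increasing.
Qed.

Lemma derive1_inj : {in X &, injective (derive1 g)}.
Proof.
move=> x y /set_mem Xx /set_mem Xy gxy.
by apply/le_anti; rewrite -(derive1_le Xx Xy) -(derive1_le Xy Xx) gxy lexx.
Qed.

Lemma derive1_continuous (x : R) : X x -> {for x, continuous (derive1 g)}.
Proof.
move=> Xx; have := g_C1.2; rewrite continuous_open_subspace //.
by apply; exact: mem_set.
Qed.

Lemma derive1_within (a b : R) : X a -> X b ->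
  {within `[a, b], continuous (derive1 g)}.
Proof.
move=> Xa Xb; apply: continuous_subspaceW g_C1.2 => z /=.
by rewrite in_itv /=; exact: X_interval.
Qed.

Lemma derive1_minimizer (x : R) : minimizer_on X g x -> derive1 g x = 0.
Proof.
move=> [Xx gx]; have /nbhs_ballP [e /= e0 eX] := open_nbhs_nbhs (conj X_open Xx).
have inX t : t \in `](x - e), (x + e)[ -> X t.
  rewrite in_itv /= => /andP[l u]; apply: eX.
  by rewrite /ball /= distrC ltr_distl l u.
rewrite derive1E; apply: derive_val.
apply: (@derive1_at_min _ _ (x - e) (x + e)); first by lra.
- by move=> t /inX /g_C1.1.
- by rewrite in_itv /=; apply/andP; split; lra.
- by move=> t /inX /gx.
Qed.

(** The increment of the derivative over a step d is continuous in the starting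
    point and positive, so it attains a positive minimum on a compact
    interval. *)
Lemma derive1_uniform_increase (A B d : R) : X A -> X B -> 0 < d ->
  exists2 w : R, 0 < w & forall x y : R, A <= x -> y <= B -> x + d <= y ->
    derive1 g x + w <= derive1 g y.
Proof.
move=> XA XB d0; have [AB|AB] := leP (A + d) B; last first.
  (* no two points of the interval are d apart, so any positive bound works *)
  by exists 1 => // x y; lra.
have AX z : z \in `[A, (B - d)] -> X z /\ X (z + d).
  by rewrite in_itv /= => /andP[lz uz]; split;
    apply: (X_interval XA XB); lra.
have [||c cI cmin] := @EVT_min R (fun z => derive1 g (z + d) - derive1 g z) A (B - d).
- by lra.
- apply: continuous_in_subspaceT => z /set_mem /AX [Xz Xzd].
  apply: cvgB; last exact: derive1_continuous.
  apply: (@continuous_comp _ _ _ (fun z => z + d)); last exact: derive1_continuous.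
  by apply: cvgD; [exact: cvg_id|exact: cvg_cst].
have [Xc Xcd] := AX _ cI.
exists (derive1 g (c + d) - derive1 g c).
  by rewrite subr_gt0 derive1_increasing // ltrDl.
move=> x y Ax yB xy.
have xI : x \in `[A, (B - d)] by rewrite in_itv /= Ax /=; lra.
have [Xx Xxd] := AX _ xI.
have Xy : X y by apply: (X_interval XA XB); lra.
have := cmin _ xI; move: xy; rewrite -(derive1_le Xxd Xy); lra.
Qed.

(** Chaining the tangent inequalities from x to the midpoint and from the
    midpoint to z leaves this product as a surplus over the tangent at x. *)
Lemma bregman_midpoint (z x : R) : X z -> X x ->
  (derive1 g x - derive1 g ((x + z) / 2)) * ((x - z) / 2) <= bregman g z x.
Proof.
move=> Xz Xx; have Xm := X_midpoint Xz Xx.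
have := bregman_ge0 Xz Xm; have := bregman_ge0 Xm Xx.
by rewrite /bregman; nra.
Qed.

Lemma bregman_uniform_gt0 (A B d : R) : X A -> X B -> 0 < d ->
  exists2 w : R, 0 < w & forall x z : R, A <= x <= B -> A <= z <= B ->
    d <= `|x - z| -> w <= bregman g z x.
Proof.
move=> XA XB d0; have d20 : 0 < d / 2 by lra.
have [w w0 wP] := derive1_uniform_increase XA XB d20.
exists (w * (d / 2)); first exact: mulr_gt0.
move=> x z /andP[Ax xB] /andP[Az zB] dxz.
have Xx : X x by apply: (X_interval XA XB); rewrite Ax.
have Xz : X z by apply: (X_interval XA XB); rewrite Az.
apply: le_trans (bregman_midpoint Xz Xx).
move: dxz; have [zx|xz] := leP z x.
  rewrite ger0_norm ?subr_ge0 // => dxz.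
  have : derive1 g ((x + z) / 2) + w <= derive1 g x by apply: wP; lra.
  by nra.
rewrite ltr0_norm ?subr_lt0 // => dxz.
have : derive1 g x + w <= derive1 g ((x + z) / 2) by apply: wP; lra.
by nra.
Qed.

End OneFunction.
End StrictlyConvex.

(** * An iteration moves the pair inwards *)

Section Bisection.
Context {R : realType}.

(** The midpoint replaces the endpoint at which g has the same sign, so the sign
    change survives each halving. *)
Lemma iter_bisect (g : R -> R) (a0 b0 : R) (r : nat) :
  a0 <= b0 -> g a0 <= 0 -> 0 <= g b0 ->
  let ab := iter r (bisect g) (a0, b0) in
  [/\ a0 <= ab.1 /\ ab.2 <= b0, g ab.1 <= 0 /\ 0 <= g ab.2 &
      ab.2 - ab.1 = (b0 - a0) / 2 ^+ r].
Proof.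
move=> ab0 ga gb /=; elim: r => [|r [[la ub] [gla gub] len]] /=.
  by rewrite expr0 divr1.
move: len; set ab := iter _ _ _ in la ub gla gub * => len.
have le_ab : ab.1 <= ab.2 by rewrite -subr_ge0 len divr_ge0 ?exprn_ge0 ?subr_ge0.
have half : (b0 - a0) / 2 ^+ r.+1 = (ab.2 - ab.1) / 2.
  by rewrite len exprS; field; rewrite expf_neq0.
rewrite /bisect half; case: (leP 0 (g _)) => gm /=.
  by split; [split; lra|split|field].
by split; [split; lra|split => //; exact: ltW|field].
Qed.

Lemma iter_bisect_half (g : R -> R) (a0 b0 : R) (r : nat) : (0 < r)%N ->
  a0 <= b0 -> g a0 <= 0 -> 0 <= g b0 ->
  let ab := iter r (bisect g) (a0, b0) in
  [/\ a0 <= ab.1, ab.2 <= b0, ab.1 <= ab.2, g ab.1 <= 0 & 0 <= g ab.2] /\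
  [/\ 2 * (ab.2 - ab.1) <= b0 - a0 & a0 < b0 -> ab.1 < ab.2].
Proof.
move=> r0 ab0 ga gb /=; have [[la ub] [gla gub] len] := iter_bisect r ab0 ga gb.
set ab := iter _ _ _ in la ub gla gub len *.
split; first by split=> //; rewrite -subr_ge0 len divr_ge0 ?exprn_ge0 ?subr_ge0.
split; last by rewrite -subr_gt0 -(subr_gt0 ab.1) len => ?; rewrite divr_gt0 ?exprn_gt0.
rewrite len -[r]prednK // exprS.
have d0 : 0 <= b0 - a0 by rewrite subr_ge0.
have p1 : 1 <= 2 ^+ r.-1 :> R by rewrite exprn_ege1 // ler1n.
have -> : 2 * ((b0 - a0) / (2 * 2 ^+ r.-1)) = (b0 - a0) / 2 ^+ r.-1.
  by field; rewrite expf_neq0.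
by rewrite ler_pdivrMr ?exprn_gt0 // ler_peMr.
Qed.
End Bisection.

(** The lower node p and the upper node q move towards each other; all that the
    convergence proof retains from one iteration.  The factor 2 records that
    there is at least one bisection round. *)
Definition inward_move {R : realType} {N : nat} (h : 'I_N -> R -> R)
    (p q : 'I_N) (x y : 'I_N -> R) : Prop :=
  [/\ [/\ x p <= y p, y p <= y q & y q <= x q],
      h p (y p) + h q (y q) = h p (x p) + h q (x q),
      2 * (y q - y p) <= x q - x p &
      forall l, l != p -> l != q -> y l = x l].

Section Step.
Context {R : realType} {N : nat} {X : set R}.
Hypothesis X_interval : is_interval X.
Variable f : 'I_N -> R -> R.
Hypothesis f_convex : forall i : 'I_N, strictly_convex_on X (f i).
Hypothesis f_C1 : forall i : 'I_N, continuously_differentiable_on X (f i).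

Let h (i : 'I_N) : R -> R := derive1 (f i).

(** The intermediate value theorem supplies a preimage between a and b, and
    injectivity identifies it with the value of the inverse. *)
Lemma inv_deriv_between (l : 'I_N) (a b v : R) : X a -> X b -> a <= b ->
  h l a <= v -> v <= h l b ->
  [/\ a <= inv_deriv X f l v, inv_deriv X f l v <= b &
      h l (inv_deriv X f l v) = v].
Proof.
move=> Xa Xb ab hav hvb.
have [||c cI hc] := @IVT R (h l) a b v ab.
- exact (derive1_within X_interval (f_C1 l) Xa Xb).
- by rewrite ge_min le_max hav hvb orbT.
move: cI; rewrite in_itv /= => /andP[ac cb].
have Xc : X c by apply: (X_interval Xa Xb); rewrite ac.
have -> : inv_deriv X f l v = c.
  rewrite -hc /inv_deriv; apply: pinvKV; last exact: mem_set.
  exact (derive1_inj X_interval (f_convex l) (f_C1 l)).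
by split.
Qed.

(** The final bracket [a, b] separates x i and x j, and the node that is not
    sent to its endpoint gets the value that balances the sum.  The sign test
    selects the node whose balancing value does not fall short of its own
    endpoint; the sign of g at the other endpoint keeps it from overshooting
    that one.  So both new values lie in [a, b], in the original order. *)
Lemma PB_step_inward (i j : 'I_N) (r : nat) (x : 'I_N -> R) : i != j ->
  (0 < r)%N -> X (x i) -> X (x j) ->
  inward_move h i j x (PB_step X f i j r x) \/
  inward_move h j i x (PB_step X f i j r x).
Proof.
move=> ij r0 Xi Xj; rewrite /inward_move /PB_step.
have ji : (j == i) = false by rewrite eq_sym; exact: negbTE.
rewrite -/(h i) -/(h j) /nearest_endpoint.
pose g z : R := h j z - h j (x j) + h i z - h i (x i).
rewrite -/g.
have hle l u v : X u -> X v -> u <= v -> h l u <= h l v.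
  by move=> Xu Xv; rewrite (derive1_le X_interval (f_convex l) (f_C1 l)).
have [xij|xji|xij] := ltgtP (x i) (x j).
- have gi : g (x i) <= 0 by rewrite /g addrK subr_le0 hle // ltW.
  have gj : 0 <= g (x j) by rewrite /g subrr add0r subr_ge0 hle // ltW.
  have [] := iter_bisect_half r0 (ltW xij) gi gj.
  case: (iter r _ _) => a b /= [la ub ab ga gb] [len /(_ ltac:(by [])) ltab].
  have Xa : X a by apply: (X_interval Xi Xj); lra.
  have Xb : X b by apply: (X_interval Xi Xj); lra.
  have /negbTE -> : ~~ (x j <= a) by rewrite -ltNge; lra.
  rewrite la; move: ga gb; rewrite /g => ga gb.
  have mid : x i - (a + b) / 2 < 0 by lra.
  rewrite nmulr_lge0 //; left.
  case: (leP (h j b - h j (x j) + h i a - h i (x i)) 0) => D /=; rewrite !eqxx ji.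
  + have [||l1 l2 e] := @inv_deriv_between i a b
      (h i (x i) - h j b + h j (x j)) Xa Xb ab; [lra|lra|].
    by rewrite e; split=> [||| l /negbTE-> /negbTE->] //; [split; lra|lra|lra].
  + have [||l1 l2 e] := @inv_deriv_between j a b
      (h j (x j) - h i a + h i (x i)) Xa Xb ab; [lra|lra|].
    by rewrite e; split=> [||| l /negbTE-> /negbTE->] //; [split; lra|lra|lra].
- have gj : g (x j) <= 0 by rewrite /g subrr add0r subr_le0 hle // ltW.
  have gi : 0 <= g (x i) by rewrite /g addrK subr_ge0 hle // ltW.
  have [] := iter_bisect_half r0 (ltW xji) gj gi.
  case: (iter r _ _) => a b /= [la ub ab ga gb] [len /(_ ltac:(by [])) ltab].
  have Xa : X a by apply: (X_interval Xj Xi); lra.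
  have Xb : X b by apply: (X_interval Xj Xi); lra.
  have /negbTE -> : ~~ (x i <= a) by rewrite -ltNge; lra.
  rewrite la; move: ga gb; rewrite /g => ga gb.
  have mid : 0 < x i - (a + b) / 2 by lra.
  rewrite pmulr_lge0 //; right.
  case: (leP 0 (h j a - h j (x j) + h i b - h i (x i))) => D /=; rewrite !eqxx ji.
  + have [||l1 l2 e] := @inv_deriv_between i a b
      (h i (x i) - h j a + h j (x j)) Xa Xb ab; [lra|lra|].
    by rewrite e; split=> [||| l /negbTE-> /negbTE->] //; [split; lra|lra|lra].
  + have [||l1 l2 e] := @inv_deriv_between j a b
      (h j (x j) - h i b + h i (x i)) Xa Xb ab; [lra|lra|].
    by rewrite e; split=> [||| l /negbTE-> /negbTE->] //; [split; lra|lra|lra].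
- (* equal estimates: the bracket is a point, and the step changes nothing *)
  have g0 : g (x i) = 0 by rewrite /g xij !subrr add0r subrr.
  have [] := @iter_bisect_half _ g (x i) (x i) r r0 (lexx _).
  + by rewrite g0.
  + by rewrite g0.
  rewrite -xij; case: (iter r _ _) => a b /= [la ub ab _ _] _.
  have -> : a = x i by lra.
  have -> : b = x i by lra.
  have -> : x i - (x i + x i) / 2 = 0 by field.
  have [||l1 l2 e] := @inv_deriv_between i (x i) (x i) (h i (x i)) Xi Xi (lexx _).
  + by [].
  + by [].
  have {l1 l2 e} fixed : inv_deriv X f i (h i (x i)) = x i.
    by apply/le_anti; rewrite l2.
  rewrite mulr0 !lexx xij subrK -xij; left; rewrite /= !eqxx ji fixed.
  by split=> [||| l /negbTE-> /negbTE->] //; lra.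
Qed.
End Step.

(** * Consensus from vanishing gaps *)

Section InwardMove.
Context {R : realType} {N : nat}.

Lemma sum_diff_pair (F G : 'I_N -> R) (p q : 'I_N) : p != q ->
  (forall l, l != p -> l != q -> F l = G l) ->
  \sum_l F l - \sum_l G l = (F p - G p) + (F q - G q).
Proof.
move=> pq FG; rewrite -sumrB (bigD1 p) //= (bigD1 q) /=; last by rewrite eq_sym.
by rewrite big1 ?addr0 // => l /andP[lp lq]; rewrite FG // subrr.
Qed.

Lemma inward_move_sum (h : 'I_N -> R -> R) (p q : 'I_N) (x y : 'I_N -> R) :
  p != q -> inward_move h p q x y -> \sum_l h l (y l) = \sum_l h l (x l).
Proof.
move=> pq [_ hsum _ same]; apply/eqP; rewrite -subr_eq0.
rewrite (sum_diff_pair pq) => [|l lp lq]; last by rewrite same.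
by apply/eqP; lra.
Qed.

Lemma inward_move_itv (h : 'I_N -> R -> R) (p q : 'I_N) (x y : 'I_N -> R)
    (A B : R) : inward_move h p q x y ->
  (forall l, A <= x l <= B) -> forall l, A <= y l <= B.
Proof.
move=> [[xyp ypq yxq] _ _ same] xAB l.
have /andP[Ap pB] := xAB p; have /andP[Aq qB] := xAB q.
have [->|lp] := eqVneq l p; first by lra.
have [->|lq] := eqVneq l q; first by lra.
by rewrite same.
Qed.

(** Cut the range into N consecutive open intervals of length d.  If each
    contained a value, picking one per interval would give an injection of the
    N indices into themselves that misses i0, since x i0 is the left end of the
    first interval. *)
Lemma empty_gap (x : 'I_N -> R) (d : R) (i0 j0 : 'I_N) : 0 < d ->
  x i0 + N%:R * d <= x j0 ->
  exists c : R, [/\ x i0 <= c, c + d <= x j0 &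
    forall l, x l <= c \/ c + d <= x l].
Proof.
move=> d0 wide; pose c (t : 'I_N) := x i0 + t%:R * d.
have [|dense] := pselect (exists t : 'I_N, forall l, x l <= c t \/ c t + d <= x l).
  move=> [t ht]; exists (c t); split => //.
    by rewrite lerDl mulr_ge0 // ltW.
  apply: le_trans wide; rewrite /c -addrA lerD2l -{2}[d]mul1r -mulrDl natr1.
  by rewrite ler_wpM2r ?ler_nat // ltW.
have inside t : exists l, c t < x l < c t + d.
  apply: contrapT => no; apply: dense; exists t => l.
  have [|lt1] := leP (x l) (c t); [by left|right].
  by rewrite leNgt; apply/negP => lt2; apply: no; exists l; rewrite lt1.
have [s sP] := choice inside.
have s_le t t' : s t = s t' -> (t' <= t)%N.
  move=> st; rewrite leqNgt; apply/negP => tt'.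
  have /andP[_ u1] := sP t; have /andP[l2 _] := sP t'.
  have : c t + d <= c t'.
    rewrite /c -addrA lerD2l -{2}[d]mul1r -mulrDl natr1.
    by rewrite ler_wpM2r ?ler_nat // ltW.
  by move: u1 l2; rewrite st; lra.
have s_inj : injective s.
  by move=> t t' st; apply/val_inj/eqP; rewrite eqn_leq !s_le.
have /codomP[t i0t] := injF_onto s_inj i0.
have := sP t; rewrite -i0t /c => /andP[].
by rewrite gtrDl ltNge mulr_ge0 // ltW.
Qed.
End InwardMove.

Section Consensus.
Context {R : realType} {N : nat}.
Variables (h : 'I_N -> R -> R) (u : nat -> {set 'I_N}) (x : nat -> 'I_N -> R).

(** The shift by one in the index matches the convention that iteration
    m.+1 transforms the state at time m. *)
Lemma E_infty_later (i j : 'I_N) (k : nat) : E_infty u i j ->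
  exists2 m : nat, (k <= m)%N & u m.+1 = [set i; j]%SET.
Proof.
move=> /andP[_ /asboolP inf]; apply: contrapT => no; apply: inf.
apply: (@sub_finite_set _ _ `I_k.+1); last exact: finite_II.
move=> [|m] //= [_ um]; rewrite ltnNge; apply/negP => km.
by apply: no; exists m.
Qed.

(** A gossiping pair with gap less than d lies on one side of the empty interval
    from c to c + d, and inward moves do not leave the hull of the pair. *)
Lemma gap_never_crossed (c d : R) (k : nat) :
  (forall m, (k <= m)%N -> exists p q : 'I_N,
     inward_move h p q (x m) (x m.+1) /\ x m q - x m p < d) ->
  (forall l, x k l <= c \/ c + d <= x k l) ->
  forall m l, (k <= m)%N ->
    (x k l <= c -> x m l <= c) /\ (c + d <= x k l -> c + d <= x m l).
Proof.
move=> small gap m l /subnKC <-; move: (m - k)%N => {}m.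
elim: m l => [|m IH] l; first by rewrite addn0.
rewrite addnS.
have [p [q [[[xyp ypq yxq] _ _ same] xpq]]] := small _ (leq_addr m k).
have [lp1 lp2] := IH p; have [lq1 lq2] := IH q; have [ll1 ll2] := IH l.
have [->|lp] := eqVneq l p.
  by split=> xk; [have [/lq1|/lq2] := gap q; have := lp1 xk; lra|
                  have := lp2 xk; lra].
have [->|lq] := eqVneq l q.
  by split=> xk; [have := lq1 xk; lra|
                  have [/lp1|/lp2] := gap p; have := lq2 xk; lra].
by rewrite same.
Qed.

(** If the spread stayed large, the nodes below an empty interval would be closed
    under the edges used infinitely often, which connectivity excludes. *)
Lemma inward_gossip_consensus :
  graph_connected (E_infty u) ->
  (forall d : R, 0 < d -> exists K, forall k, (K <= k)%N ->
    exists p q : 'I_N, [/\ u k.+1 = [set p; q]%SET,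
      inward_move h p q (x k) (x k.+1) & x k q - x k p < d]) ->
  forall e : R, 0 < e -> exists K, forall k, (K <= k)%N ->
    forall i j, x k j - x k i < e.
Proof.
move=> conn small e e0.
have [N0|N0] := eqVneq N 0%N.
  by exists 0%N => k _ i; exfalso; move: i; rewrite N0 => -[].
have NR : 0 < N%:R :> R by rewrite ltr0n lt0n.
have d0 : 0 < e / N%:R by rewrite divr_gt0.
have [K KP] := small _ d0; exists K => k Kk i j.
rewrite ltNge; apply/negP => wide.
have [||c [ic cj gap]] := @empty_gap _ _ (x k) (e / N%:R) i j.
- by [].
- by rewrite mulrCA divff ?mulr1 ?gt_eqF //; lra.
have stay : forall m l, (k <= m)%N ->
    (x k l <= c -> x m l <= c) /\ (c + e / N%:R <= x k l -> c + e / N%:R <= x m l).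
  apply: gap_never_crossed gap => m km.
  by have [p [q [_ mv lt_d]]] := KP m (leq_trans Kk km); exists p, q.
have closed_below : fingraph.closed (E_infty u) [pred l | x k l <= c].
  move=> a b /(E_infty_later k) [m km um]; rewrite !inE.
  have [p [q [um' [[xyp ypq yxq] _ _ _] lt_d]]] := KP m (leq_trans Kk km).
  have pq_same : (x k p <= c) = (x k q <= c).
    have [p1 p2] := stay m p km; have [q1 q2] := stay m q km.
    have [kp|kp] := gap p; have [kq|kq] := gap q.
    - by rewrite kp kq.
    - by have := p1 kp; have := q2 kq; lra.
    - by have := p2 kp; have := q1 kq; lra.
    - by rewrite !leNgt; congr (~~ _); apply/idP/idP => _; lra.
  have /set2P[->|->] : a \in [set p; q]%SET by rewrite -um' um set21.
  - have /set2P[->|->] : b \in [set p; q]%SET by rewrite -um' um set22.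
    + by [].
    + exact: pq_same.
  - have /set2P[->|->] : b \in [set p; q]%SET by rewrite -um' um set22.
    + exact: esym.
    + by [].
have := closed_connect closed_below (conn i j).
by rewrite !inE ic => /esym; lra.
Qed.
End Consensus.

(** * The Lyapunov function and the limit *)

Section Lyapunov.
Context {R : realType} {N : nat} {X : set R}.
Hypotheses (X_open : open X) (X_interval : is_interval X).
Variable f : 'I_N -> R -> R.
Hypothesis f_convex : forall i : 'I_N, strictly_convex_on X (f i).
Hypothesis f_C1 : forall i : 'I_N, continuously_differentiable_on X (f i).

Let h (i : 'I_N) : R -> R := derive1 (f i).

Lemma V_ge0 (c : R) (x : 'I_N -> R) : X c -> (forall l, X (x l)) ->
  0 <= V f c x.
Proof.
by move=> Xc Xx; apply: sumr_ge0 => l _; exact: bregman_ge0 (f_convex l) (f_C1 l) _ _ _ _.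
Qed.

(** Node l lowers its term of V by its Bregman divergence plus
    (h l (y l) - h l (x l)) * (c - y l).  The transfers of h between p and q are
    opposite, so c cancels and the second parts add up to the transfer times
    y q - y p, which is nonnegative. *)
Lemma V_inward_move (c : R) (p q : 'I_N) (x y : 'I_N -> R) : p != q ->
  (forall l, X (x l)) -> (forall l, X (y l)) -> inward_move h p q x y ->
  V f c y + (bregman (f p) (y p) (x p) + bregman (f q) (y q) (x q)) <= V f c x.
Proof.
move=> pq Xx Xy [[xyp ypq yxq] hsum _ same].
have dV : V f c x - V f c y =
    bregman (f p) c (x p) - bregman (f p) c (y p) +
    (bregman (f q) c (x q) - bregman (f q) c (y q)).
  by apply: (sum_diff_pair pq) => l lp lq; rewrite same.
have : h p (x p) <= h p (y p).
  by rewrite (derive1_le X_interval (f_convex p) (f_C1 p)).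
move: hsum dV; rewrite /h /bregman => hsum dV mono.
suff : 0 <= (derive1 (f p) (y p) - derive1 (f p) (x p)) * (y q - y p) by nra.
by rewrite mulr_ge0 // subr_ge0.
Qed.

Lemma bregman_uniform_gt0_family (A B d : R) : X A -> X B -> 0 < d ->
  exists2 w : R, 0 < w & forall (i : 'I_N) (x z : R),
    A <= x <= B -> A <= z <= B -> d <= `|x - z| -> w <= bregman (f i) z x.
Proof.
move=> XA XB d0.
have /fin_all_exists2 [w w0 wP] := fun i => bregman_uniform_gt0 X_open
  X_interval (f_convex i) (f_C1 i) XA XB d0.
exists (\big[Num.min/1]_i w i).
  by elim/big_ind: _ => // a b a0 b0; rewrite lt_min a0.
by move=> i x z xAB zAB dxz; apply: le_trans (wP i x z xAB zAB dxz); exact: bigmin_le.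
Qed.

Section Trajectory.
Variables (u : nat -> {set 'I_N}) (x : nat -> 'I_N -> R).
Hypothesis moves : forall k, exists p q : 'I_N,
  [/\ p != q, u k.+1 = [set p; q]%SET & inward_move h p q (x k) (x k.+1)].

Lemma trajectory_sum k : \sum_l h l (x k l) = \sum_l h l (x 0%N l).
Proof.
elim: k => // k <-; have [p [q [pq _ mv]]] := moves k.
exact: inward_move_sum pq mv.
Qed.

Variables A B : R.
Hypotheses (XA : X A) (XB : X B) (x0AB : forall l, A <= x 0%N l <= B).

Lemma trajectory_itv k l : A <= x k l <= B.
Proof.
elim: k l => // k IH; have [p [q [pq _ mv]]] := moves k.
exact: inward_move_itv mv IH.
Qed.

Lemma trajectory_X k l : X (x k l).
Proof. exact: X_interval XA XB _ (trajectory_itv k l). Qed.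

(** A pair with gap at least d closes half of it when it gossips, so one of its
    nodes moves by at least d / 4, which costs V a fixed positive amount. *)
Lemma gossiping_gap_cvg0 (d : R) : 0 < d -> exists K, forall k, (K <= k)%N ->
  exists p q : 'I_N, [/\ u k.+1 = [set p; q]%SET,
    inward_move h p q (x k) (x k.+1) & x k q - x k p < d].
Proof.
move=> d0; have d40 : 0 < d / 4 by lra.
have [w w0 wP] := bregman_uniform_gt0_family XA XB d40.
(* V_inward_move holds for every reference point, so the minimizer can be
   replaced by an endpoint of the invariant interval *)
pose v k := V f A (x k).
have v_step k (p q : 'I_N) : p != q -> inward_move h p q (x k) (x k.+1) ->
    v k.+1 + (bregman (f p) (x k.+1 p) (x k p) +
              bregman (f q) (x k.+1 q) (x k q)) <= v k.
  by move=> pq mv; apply: V_inward_move => // l; exact: trajectory_X.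
have breg0 k l : 0 <= bregman (f l) (x k.+1 l) (x k l).
  by apply: bregman_ge0 (f_convex l) (f_C1 l) _ _ _ _; exact: trajectory_X.
have v_cvg : cvgn v.
  apply: nonincreasing_is_cvgn.
    apply/nonincreasing_seqP => k; have [p [q [pq _ mv]]] := moves k.
    by have := v_step k p q pq mv; have := breg0 k p; have := breg0 k q; lra.
  exists 0 => _ [k _ <-]; apply: V_ge0 => // l; exact: trajectory_X.
have dv_cvg : (v k - v k.+1) @[k --> \oo] --> (0 : R).
  rewrite -(subrr (limn v)); apply: cvgB => //.
  by have := v_cvg; rewrite -(cvg_shiftS v).
have /cvgr0Pnorm_lt /(_ w w0) [K _ KP] := dv_cvg.
exists K => k /KP /= small; have [p [q [pq um mv]]] := moves k.
exists p, q; split => //; rewrite ltNge; apply/negP => wide.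
have := v_step k p q pq mv; have := breg0 k p; have := breg0 k q.
have {small} := le_lt_trans (ler_norm _) small.
have [[xyp ypq yxq] _ half _] := mv.
have [far|near_p] := leP (d / 4) (x k.+1 p - x k p).
  have : w <= bregman (f p) (x k.+1 p) (x k p).
    by apply: wP; rewrite ?trajectory_itv // ler0_norm; lra.
  by lra.
have : w <= bregman (f q) (x k.+1 q) (x k q).
  by apply: wP; rewrite ?trajectory_itv // ger0_norm; lra.
by lra.
Qed.

(** The point c cannot lie strictly on one side of all estimates, since the h l
    are increasing and their sums at c and at the estimates are both 0. *)
Lemma trajectory_near_zero (c e : R) (k : nat) : X c -> 
  \sum_l h l c = 0 -> \sum_l h l (x 0%N l) = 0 ->
  (forall i j, x k j - x k i < e) -> forall i, `|c - x k i| < e.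
Proof.
move=> Xc hc hx0 spread i.
have hlt l a b : X a -> X b -> a < b -> h l a < h l b.
  exact: (derive1_increasing X_interval (f_convex l) (f_C1 l)).
have sum_k := trajectory_sum k; rewrite hx0 in sum_k.
have has_i : has predT (index_enum 'I_N).
  by apply/hasP; exists i; rewrite ?mem_index_enum.
have ex_le : exists j, x k j <= c.
  apply: contrapT => no.
  have : \sum_l h l c < \sum_l h l (x k l).
    apply: ltr_sum => // l _; apply: hlt => //; first exact: trajectory_X.
    by rewrite ltNge; apply/negP => xl; apply: no; exists l.
  by rewrite hc sum_k ltxx.
have ex_ge : exists j, c <= x k j.
  apply: contrapT => no.
  have : \sum_l h l (x k l) < \sum_l h l c.
    apply: ltr_sum => // l _; apply: hlt => //; first exact: trajectory_X.
    by rewrite ltNge; apply/negP => xl; apply: no; exists l.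
  by rewrite hc sum_k ltxx.
have [j1 j1c] := ex_le; have [j2 j2c] := ex_ge.
have := spread i j2; have := spread j1 i; rewrite ltr_norml.
by move=> s1 s2; apply/andP; split; lra.
Qed.
End Trajectory.

Lemma sum_derive1_zero (A B : R) (xmin : 'I_N -> R) :
  X A -> X B -> A <= B -> (forall i, A <= xmin i <= B) ->
  \sum_i h i (xmin i) = 0 ->
  exists2 c, X c & \sum_i h i c = 0.
Proof.
move=> XA XB AB minAB h0.
have Xm i : X (xmin i) by exact: X_interval XA XB _ (minAB i).
have XAB z : z \in `[A, B] -> X z.
  by rewrite in_itv /=; exact: X_interval.
have [||c cI hc] := @IVT R (fun z => \sum_i h i z) A B 0 AB.
- apply: continuous_in_subspaceT => z /set_mem /XAB Xz.
  apply: cvg_big => [|i _]; first exact: add_continuous.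
  exact: derive1_continuous (f_C1 i) _ _.
- rewrite ge_min le_max; apply/andP; split; apply/orP.
    left; rewrite -[leRHS]h0; apply: ler_sum => i _.
    by rewrite (derive1_le X_interval (f_convex i) (f_C1 i)) //; case/andP: (minAB i).
  right; rewrite -[leLHS]h0; apply: ler_sum => i _.
  by rewrite (derive1_le X_interval (f_convex i) (f_C1 i)) //; case/andP: (minAB i).
by exists c => //; exact: XAB.
Qed.

(** The linear parts of the divergences cancel at a zero of the total
    derivative. *)
Lemma total_objective_bregman (c y : R) : \sum_i h i c = 0 ->
  total_objective f y - total_objective f c = \sum_i bregman (f i) y c.
Proof.
move=> hc; rewrite /bregman sumrB -mulr_suml -/(h _).
by rewrite [X in X * _]hc mul0r subr0 sumrB.
Qed.

Lemma zero_unique_minimizer (i0 : 'I_N) (c : R) : X c -> \sum_i h i c = 0 ->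
  unique (minimizer_on X (total_objective f)) c.
Proof.
move=> Xc hc; have breg0 y i : X y -> 0 <= bregman (f i) y c.
  by move=> Xy; exact: bregman_ge0 (f_convex i) (f_C1 i) _ _ _ _.
split=> [|y [Xy yP]].
  split=> // y Xy; rewrite -subr_ge0 total_objective_bregman //.
  by apply: sumr_ge0 => i _; exact: breg0.
apply: contrapT => /eqP cy; have := yP c Xc; apply/negP.
rewrite -ltNge -subr_gt0 total_objective_bregman // (bigD1 i0) //=.
rewrite ltr_wpDr ?sumr_ge0 // => [i _|]; first exact: breg0.
by apply: bregman_gt0 (f_convex i0) (f_C1 i0) _ _ _ _ _; rewrite // eq_sym.
Qed.

Lemma V_cvg0 (c : R) (x : nat -> 'I_N -> R) : X c ->
  (forall i, x k i @[k --> \oo] --> c) -> V f c (x k) @[k --> \oo] --> (0 : R).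
Proof.
move=> Xc xc.
have -> : 0 = \sum_(i < N) (f i c - f i c - h i c * (c - c)) :> R.
  by rewrite big1 // => i _; rewrite !subrr mulr0 subrr.
apply: cvg_big => [|i _]; first exact: add_continuous.
have cf : {for c, continuous (f i)}.
  by apply: differentiable_continuous; apply/derivable1_diffP; exact: (f_C1 i).1.
have ch : {for c, continuous (h i)} by exact: derive1_continuous (f_C1 i) _ Xc.
apply: cvgB; first by apply: cvgB; [exact: cvg_cst|exact: continuous_cvg].
by apply: cvgM; [exact: continuous_cvg|apply: cvgB; [exact: cvg_cst|]].
Qed.
End Lyapunov.

Theorem theorem2 (R : realType) (N : nat) (hN : (2 <= N)%N)
    (X : set R) (X_nonempty : X !=set0) (X_open : open X)
    (X_interval : is_interval X)
    (f : 'I_N -> R -> R)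
    (f_convex : forall i : 'I_N, strictly_convex_on X (f i))
    (f_C1 : forall i : 'I_N, continuously_differentiable_on X (f i))
    (xmin : 'I_N -> R)
    (f_min : forall i : 'I_N, minimizer_on X (f i) (xmin i))
    (u : nat -> {set 'I_N}) (hu : gossiping_pairs u)
    (u_connected : graph_connected (E_infty u))
    (xhat : nat -> 'I_N -> R) (hPB : PB_sequence X f xmin u xhat) :
  exists2 xstar : R,
    unique (minimizer_on X (total_objective f)) xstar &
    (V f xstar (xhat k) @[k --> \oo] --> (0 : R)) /\
    (forall i : 'I_N, xhat k i @[k --> \oo] --> xstar).
Proof.
have i0 : 'I_N := Ordinal (ltnW hN).
have Xmin i : X (xmin i) := (f_min i).1.
have [iA _ /(_ _ isT) leA] := arg_minP xmin (isT : xpredT i0).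
have [iB _ /(_ _ isT) leB] := arg_maxP xmin (isT : xpredT i0).
have minAB i : xmin iA <= xmin i <= xmin iB by rewrite leA; exact: leB.
have h0 : \sum_i derive1 (f i) (xmin i) = 0.
  by rewrite big1 // => i _; exact (derive1_minimizer X_open (f_C1 i) (f_min i)).
have [x0E steps] := hPB.
have x0min : xhat 0%N = xmin by apply/funext.
have moves k : (forall l, X (xhat k l)) -> exists p q : 'I_N,
    [/\ p != q, u k.+1 = [set p; q]%SET &
        inward_move (fun i => derive1 (f i)) p q (xhat k) (xhat k.+1)].
  move=> Xk; have [i [j [r [uk r0 /funext stepE]]]] := steps k.+1 isT.
  have ij : i != j.
    by have := hu k.+1 isT; rewrite uk cards2; case: eqP.
  rewrite stepE /=.
  have [mv|mv] := PB_step_inward X_interval f_convex f_C1 ij r0 (Xk i) (Xk j).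
    by exists i, j.
  by exists j, i; split; rewrite // 1?eq_sym // finset.setUC.
have x_itv k l : xmin iA <= xhat k l <= xmin iB.
  elim: k l => [l|k IH]; first by rewrite x0min.
  have [|p [q [_ _ mv]]] := moves k.
    by move=> l; exact: X_interval (Xmin iA) (Xmin iB) _ (IH l).
  exact: inward_move_itv mv IH.
have {}moves k := moves k (fun l => X_interval _ _ (Xmin iA) (Xmin iB) _ (x_itv k l)).
have x0_itv := x_itv 0%N.
have [c Xc hc] := sum_derive1_zero X_open X_interval f_convex f_C1
  (Xmin iA) (Xmin iB) (leA iB) minAB h0.
have small := gossiping_gap_cvg0 X_open X_interval f_convex f_C1 moves
  (Xmin iA) (Xmin iB) x0_itv.
have x_cvg i : xhat k i @[k --> \oo] --> c.
  apply/cvgrPdist_lt => e e0.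
  have [K KP] := inward_gossip_consensus u_connected small e0.
  exists K => // k /= Kk.
  apply: (trajectory_near_zero X_interval f_convex f_C1 moves
    (Xmin iA) (Xmin iB) x0_itv) => //; last exact: KP.
  by rewrite x0min.
exists c; first exact: (zero_unique_minimizer X_interval f_convex f_C1 i0 Xc hc).
by split=> //; exact: (V_cvg0 X_open f_C1).
Qed.
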